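(* Let $G$ be an $n$-vertex graph. Then $G$ contains a relatively half-full subgraph with $\lfloor \frac{n}{2} \rfloor$ or $\lfloor \frac{n}{2} \rfloor + 1$ vertices.
   Context: Graphs are finite and simple. For a graph $G$, a relatively half-full subgraph of $G$ is a subgraph $H$ of $G$ such that $d_H(v) \geq \frac{1}{2} d_G(v)$ for every $v \in V(H)$, where $d_H(v)$ and $d_G(v)$ denote the degrees of $v$ in $H$ and $G$. (The empty subgraph on $0$ vertices satisfies this vacuously.) *)

(* Defs.v *)
From mathcomp Require Import all_boot.

Set Implicit Arguments.
Unset Strict Implicit.
Unset Printing Implicit Defensive.

Record sgraph := SGraph {
  vertex :> finType;
  edge : rel vertex;
  edge_sym : symmetric edge;
  edge_irr : irreflexive edge
}.

Definition degree (G : sgraph) (v : G) : nat := #|[set w | edge v w]|.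

(* Not necessarily induced: [sedge] may omit edges of [G] inside [sverts].
   Irreflexivity of [sedge] follows from that of [edge]. *)
Record subgraph (G : sgraph) := Subgraph {
  sverts : {set G};
  sedge : rel G;
  sedge_sym : symmetric sedge;
  sedge_sub : forall x y, sedge x y -> [/\ edge x y, x \in sverts & y \in sverts]
}.

Definition sdegree (G : sgraph) (H : subgraph G) (v : G) : nat :=
  #|[set w | sedge H v w]|.

(* d_H(v) >= d_G(v) / 2, with the denominator cleared to stay in [nat]. *)
Definition relatively_half_full (G : sgraph) (H : subgraph G) : Prop :=
  forall v : G, v \in sverts H -> degree v <= 2 * sdegree H v.

(* Main.v *)
Require Import Defs.
From mathcomp Require Import all_boot.
From mathcomp Require Import zify.

(** Minimise the number of edges leaving a vertex set A of size ceil(n/2); call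
    a vertex bad if it has more neighbours across the cut than on its own side.
    If n is odd, moving a bad vertex out of A would give a cut of the same
    shape with fewer edges, so A is half-full.  If n is even and both sides
    have bad vertices a and b, then swapping them would reduce the cut unless a
    and b are adjacent and each has an excess of exactly 1; hence moving a to
    the other side cures all the bad vertices there, and a itself is
    good in its new place. *)

Section Cut.

Set Implicit Arguments.
Unset Strict Implicit.

Variable G : sgraph.
Implicit Types (A : {set G}) (v x y : G).

(** Booleans are summed as numbers so that the [bigop] lemmas on removing a point and exchanging
    sums apply directly. *)
Definition degree_in A v : nat := \sum_(w in A) edge v w.

Definition cut A : nat := \sum_(v in A) degree_in (~: A) v.

Lemma degree_inE A v : degree_in A v = #|[set w in A | edge v w]|.
Proof.
rewrite /degree_in -sum1_card big_mkcond [RHS]big_mkcond /=.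
by apply: eq_bigr => w _; rewrite inE; case: (w \in A); case: (edge v w).
Qed.

Lemma degree_in_setC A v : degree v = degree_in A v + degree_in (~: A) v.
Proof.
rewrite !degree_inE /degree -(cardsID A [set w | edge v w]).
by congr (_ + _); apply: eq_card => w; rewrite !inE andbC.
Qed.

Lemma degree_inD1 x A v : x \in A ->
  degree_in A v = edge v x + degree_in (A :\ x) v.
Proof. by move=> xA; rewrite /degree_in (big_setD1 x). Qed.

Lemma degree_inU1 x A v : x \notin A ->
  degree_in (x |: A) v = edge v x + degree_in A v.
Proof. by move=> xA; rewrite /degree_in (big_setU1 x). Qed.

Lemma setCD1 A x : ~: (A :\ x) = x |: ~: A.
Proof. by rewrite setCD setUC. Qed.

Lemma cutC A : cut (~: A) = cut A.
Proof.
rewrite /cut /degree_in setCK exchange_big; apply: eq_bigr => x _.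
by apply: eq_bigr => y _; rewrite edge_sym.
Qed.

(** When [x] changes sides, its edges to [~: A] leave the cut and those to [A] enter it. The
    additive form avoids truncated subtraction. *)
Lemma cutD1 A x : x \in A ->
  cut (A :\ x) + degree_in (~: A) x = cut A + degree_in A x.
Proof.
move=> xA; rewrite /cut (big_setD1 x xA) /= setCD1.
under eq_bigr => y _ do rewrite (@degree_inU1 x) ?inE ?xA//.
rewrite big_split /= (degree_inD1 x xA) edge_irr.
have -> : \sum_(y in A :\ x) edge y x = degree_in (A :\ x) x.
  by apply: eq_bigr => y _; rewrite edge_sym.
lia.
Qed.

(** Both sets become [A :\ x] after one deletion, so [cutD1] applies twice. An edge between [x] and
    [y] stays in the cut, but both degree terms count it as lost, hence the correction by 2. *)
Lemma cut_swap A x y : x \in A -> y \notin A ->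
  cut (y |: (A :\ x)) + degree_in (~: A) x + degree_in A y =
  cut A + degree_in A x + degree_in (~: A) y + 2 * edge x y.
Proof.
move=> xA yA; have yAx : y \notin A :\ x by rewrite !inE negb_and yA orbT.
have := cutD1 xA; have := @cutD1 (y |: A :\ x) y (setU11 _ _).
rewrite setU1K // degree_inU1 // edge_irr (degree_inD1 y xA).
have := @degree_inD1 y (~: (A :\ x)) y.
have -> : ~: (A :\ x) :\ y = ~: (y |: A :\ x).
  by apply/setP => z; rewrite !inE negb_or.
rewrite inE yAx edge_irr => /(_ isT).
by rewrite setCD1 degree_inU1 ?inE ?xA // (edge_sym y x); lia.
Qed.

Definition induced_edge A : rel G :=
  fun x y => [&& edge x y, x \in A & y \in A].

Lemma induced_edge_sym A : symmetric (induced_edge A).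
Proof. by move=> x y; rewrite /induced_edge edge_sym [(x \in A) && _]andbC. Qed.

Lemma induced_edge_sub A x y :
  induced_edge A x y -> [/\ edge x y, x \in A & y \in A].
Proof. by move/and3P. Qed.

Definition induced A : subgraph G :=
  Subgraph (@induced_edge_sym A) (@induced_edge_sub A).

(** As [degree v] splits over [A] and its complement, having half of it in [A] means having at least
    as much in [A] as outside. *)
Lemma induced_half_full A :
  (forall v, v \in A -> degree_in (~: A) v <= degree_in A v) ->
  relatively_half_full (induced A).
Proof.
move=> goodA v /= vA.
have -> : sdegree (induced A) v = degree_in A v.
  rewrite degree_inE; apply: eq_card => w.
  by rewrite !inE /= /induced_edge vA andbC.
by rewrite (degree_in_setC A); have := goodA v vA; lia.
Qed.

Lemma min_cut k : k <= #|G| ->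
  exists2 A : {set G}, #|A| = k & forall B : {set G}, #|B| = k -> cut A <= cut B.
Proof.
move=> lekG.
(* The minimum needs some set of size [k] to start from. *)
have cardk : #|[set x in take k (enum G)]| == k.
  rewrite cardsE (card_uniqP _) ?take_uniq ?enum_uniq //.
  by rewrite size_take_min -cardE; apply/eqP/minn_idPl.
case: (@arg_minnP _ _ (fun A : {set G} => #|A| == k) cut cardk) => A /eqP cardA minA.
by exists A => // B /eqP /minA.
Qed.

Lemma half_full_or_bad A :
  relatively_half_full (induced A) \/
  exists2 v, v \in A & degree_in A v < degree_in (~: A) v.
Proof.
case: (boolP [exists v in A, degree_in A v < degree_in (~: A) v]).
  by move=> /exists_inP; right.
rewrite negb_exists_in => /forall_inP goodA; left.
by apply: induced_half_full => v /goodA; rewrite -leqNgt.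
Qed.

Lemma half_full_odd k : #|G| = k.*2.+1 ->
  exists2 A, relatively_half_full (induced A) & #|A| = k.+1.
Proof.
move=> cardG; have [|A cardA minA] := @min_cut k.+1; first lia.
have [goodA|[a aA bad_a]] := half_full_or_bad A; first by exists A.
have cardAa : #|A :\ a| = k by have := cardsD1 a A; rewrite aA; lia.
have cardCAa : #|~: (A :\ a)| = k.+1 by have := cardsC (A :\ a); lia.
by have := minA _ cardCAa; have := cutD1 aA; rewrite cutC; lia.
Qed.

Lemma half_full_even k : #|G| = k.*2 ->
  exists2 A, relatively_half_full (induced A) & #|A| = k \/ #|A| = k.+1.
Proof.
move=> cardG; have [|A cardA minA] := @min_cut k; first lia.
have cardCA : #|~: A| = k by have := cardsC A; lia.
have [goodA|[a aA bad_a]] := half_full_or_bad A; first by exists A; [|left].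
have aCA : a \notin ~: A by rewrite inE aA.
exists (a |: ~: A); last by right; rewrite cardsU1 aCA cardCA.
apply: induced_half_full => v.
have -> : ~: (a |: ~: A) = A :\ a by rewrite -setCD1 setCK.
rewrite degree_inU1 // in_setU1 => /predU1P[->|].
  by have := degree_inD1 a aA; lia.
rewrite inE => vA.
(* Minimality against swapping [a] and [v] bounds the excess of [v] towards [A] by -1 if [v] is not
   adjacent to [a], and by 1 if it is; in the latter case the move of [a] lowers that excess by
   2. *)
have cardS : #|v |: A :\ a| = k.
  by have := cardsD1 a A; rewrite cardsU1 !inE (negPf vA) aA andbF; lia.
have := minA _ cardS; have := cut_swap aA vA; have := degree_inD1 v aA.
by rewrite (edge_sym a v); case: (edge v a) => /=; lia.
Qed.

End Cut.

Theorem theorem5 (G : sgraph) (n : nat) (hn : #|G| = n) :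
  exists H : subgraph G,
    relatively_half_full H /\
    (#|sverts H| = n %/ 2 \/ #|sverts H| = n %/ 2 + 1).
Proof.
rewrite divn2 addn1; have := odd_double_half n; case: (odd n) => /= nE.
  have [|A goodA cardA] := @half_full_odd G n./2; first by rewrite hn -[LHS]nE.
  by exists (induced A); split; [|right].
have [|A goodA cardA] := @half_full_even G n./2; first by rewrite hn -[LHS]nE.
by exists (induced A).
Qed.
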